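(* Let $\mathcal{X}\subset\mathbb{R}^n$ be open and let $\Phi\in C^0(\mathcal{X},\mathbb{R}^{n_{\mathrm{out}}})$ be a map which has at least one component $\Phi_i\in C^0(\mathcal{X},\mathbb{R})$, $i\in\{1,\ldots,n_{\mathrm{out}}\}$, which is a topological Morse function with a topologically critical point. Then, under Assumptions 1 and 2, the map $\Phi$ cannot be embedded in the neural ODE architecture $\mathrm{NODE}_{(2)}$; i.e. there are no vector field $f$ satisfying Assumptions 1 and 2, matrix $A\in\mathbb{R}^{n_{\mathrm{out}}\times n}$ and vector $a\in\mathbb{R}^{n_{\mathrm{out}}}$ such that $\Phi(x)=A\cdot h_x(T)+a$ for all $x\in\mathcal{X}$.
   Context: Fix $T>0$. A basic neural ODE is the initial value problem $\frac{dh}{dt}=f(h(t),t)$, $h(0)=x\in\mathcal{X}\subset\mathbb{R}^n$, with $f:\mathbb{R}^n\times[0,T]\to\mathbb{R}^n$ continuous; its solution is denoted $h_x$. A neural ODE with a linear layer is the map $\mathrm{NODE}_{(2)}:\mathcal{X}\to\mathbb{R}^{n_{\mathrm{out}}}$, $\mathrm{NODE}_{(2)}(x):=A\cdot h_x(T)+a$, with $A\in\mathbb{R}^{n_{\mathrm{out}}\times n}$ and $a\in\mathbb{R}^{n_{\mathrm{out}}}$. Assumption 1: the vector field $f$ is continuous and the solution of the initial value problem exists for all $t\in[0,T]$. Assumption 2: the vector field $f$ is continuous and the solution of the initial value problem is unique for all $t\in\mathcal{I}$, where $\mathcal{I}$ is the maximal time interval of existence; uniqueness is understood in the sense that solution curves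 do not cross (two solutions of the ODE that agree at some time agree at all times at which both exist). Let $\Psi\in C^0(\mathcal{X},\mathbb{R})$ with $\mathcal{X}\subset\mathbb{R}^n$ open. A point $q\in\mathcal{X}$ is topologically ordinary if there exist a neighborhood $\mathcal{V}$ of $0\in\mathbb{R}^n$ and a homeomorphism $\eta:\mathcal{V}\to\eta(\mathcal{V})$ (onto its image in $\mathcal{X}$) with $\eta(0)=q$ and $\Psi(\eta(v_1,\ldots,v_n))=\Psi(q)+v_n$ for all $(v_1,\ldots,v_n)\in\mathcal{V}$. A point $p\in\mathcal{X}$ that is not topologically ordinary is topologically critical. A topologically critical point $p$ has index $k$ if there exist a neighborhood $\mathcal{U}$ of $0\in\mathbb{R}^n$ and a homeomorphism $\mu:\mathcal{U}\to\mu(\mathcal{U})$ (onto its image in $\mathcal{X}$) with $\mu(0)=p$ and $\Psi(\mu(u_1,\ldots,u_n))=\Psi(p)-\sum_{j=1}^k u_j^2+\sum_{j=k+1}^n u_j^2$ for all $(u_1,\ldots,u_n)\in\mathcal{U}$. $\Psi$ is a topological Morse function if every topologically critical point of $\Psi$ has some index in $\{0,1,\ldots,n\}$. *)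

(* Defs.v *)
From HB Require Import structures.
From mathcomp Require Import all_boot all_order all_algebra.
From mathcomp Require Import all_classical all_reals all_analysis.

Set Implicit Arguments.
Unset Strict Implicit.
Unset Printing Implicit Defensive.

Import Order.TTheory GRing.Theory Num.Theory.
Import numFieldNormedType.Exports.

Local Open Scope classical_set_scope.
Local Open Scope ring_scope.

Section ode.
Context {R : realType} {n : nat}.
Implicit Types (T : R) (f : 'cV[R]_n -> R -> 'cV[R]_n) (h : R -> 'cV[R]_n).

(* A vector field is a total function; only its values on R^n x [0, T] are
   ever used. *)
Definition vector_field_continuous T f : Prop :=
  {within [set: 'cV[R]_n] `*` `[0, T],
    continuous (fun p : 'cV[R]_n * R => f p.1 p.2)}.

(* The difference quotient is taken along J, so that the derivative is
   one-sided at an endpoint of J belonging to J. *)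
Definition ode_solution f (J : interval R) h : Prop :=
  forall t, t \in J ->
    (s - t)^-1 *: (h s - h t) @[s --> within [set` J] t^'] --> f (h t) t.

Definition ivp_solution T f (x : 'cV[R]_n) h : Prop :=
  ode_solution f `[0, T] h /\ h 0 = x.

Definition ivp_exists T f (X : set 'cV[R]_n) : Prop :=
  forall x, X x -> exists h, ivp_solution T f x h.

(* J1 and J2 range over all subintervals of [0, T], so that solutions which
   are not defined on the whole of [0, T] are covered too. *)
Definition solutions_do_not_cross T f : Prop :=
  forall (J1 J2 : interval R) h1 h2,
    [set` J1] `<=` `[0, T] -> [set` J2] `<=` `[0, T] ->
    ode_solution f J1 h1 -> ode_solution f J2 h2 ->
    (exists t, [/\ t \in J1, t \in J2 & h1 t = h2 t]) ->
    forall t, t \in J1 -> t \in J2 -> h1 t = h2 t.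

Definition assumption1 T f (X : set 'cV[R]_n) : Prop :=
  vector_field_continuous T f /\ ivp_exists T f X.

Definition assumption2 T f : Prop :=
  vector_field_continuous T f /\ solutions_do_not_cross T f.

(* The solution h_x; under both assumptions its values on [0, T] do not depend
   on the choice made by xget, and its values elsewhere are irrelevant. *)
Definition ivp_sol T f (x : 'cV[R]_n) : R -> 'cV[R]_n :=
  xget (fun=> 0) [set h | ivp_solution T f x h].

Definition NODE2 {m : nat} T f (A : 'M[R]_(m, n)) (a : 'cV[R]_m)
    (x : 'cV[R]_n) : 'cV[R]_m :=
  A *m ivp_sol T f x T + a.

End ode.

Definition homeomorphism_onto_image {U V : topologicalType}
    (D : set U) (e : U -> V) : Prop :=
  {within D, continuous e} /\
  exists g : V -> U,
    {within e @` D, continuous g} /\ (forall u, D u -> g (e u) = u).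

(* The dimension is n.+1 because the definition of an ordinary point refers to
   the last coordinate; the coordinates are numbered from 0 to n. *)
Section topological_morse.
Context {R : realType} {n : nat}.
Implicit Types (X : set 'cV[R]_n.+1) (Psi : 'cV[R]_n.+1 -> R).

Definition topologically_ordinary X Psi (q : 'cV[R]_n.+1) : Prop :=
  exists (V : set 'cV[R]_n.+1) (eta : 'cV[R]_n.+1 -> 'cV[R]_n.+1),
    [/\ nbhs (0 : 'cV[R]_n.+1) V, homeomorphism_onto_image V eta, eta @` V `<=` X, eta 0 = q &
      forall v, V v -> Psi (eta v) = Psi q + v ord_max 0].

Definition topologically_critical X Psi (p : 'cV[R]_n.+1) : Prop :=
  X p /\ ~ topologically_ordinary X Psi p.

Definition has_index X Psi (p : 'cV[R]_n.+1) (k : nat) : Prop :=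
  exists (U : set 'cV[R]_n.+1) (mu : 'cV[R]_n.+1 -> 'cV[R]_n.+1),
    [/\ nbhs (0 : 'cV[R]_n.+1) U, homeomorphism_onto_image U mu, mu @` U `<=` X, mu 0 = p &
      forall u, U u ->
        Psi (mu u) = Psi p - \sum_(j < n.+1 | (j < k)%N) u j 0 ^+ 2
                           + \sum_(j < n.+1 | (k <= j)%N) u j 0 ^+ 2].

Definition topological_morse X Psi : Prop :=
  {within X, continuous Psi} /\
  forall p, topologically_critical X Psi p ->
    exists k : nat, (k <= n.+1)%N /\ has_index X Psi p k.

End topological_morse.

(* Main.v *)
Require Import Defs.
From HB Require Import structures.
From mathcomp Require Import all_boot all_order all_algebra.
From mathcomp Require Import all_classical all_reals all_analysis.
From mathcomp Require Import perm zify lra ring.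

Import Order.TTheory GRing.Theory Num.Theory.
Import numFieldNormedType.Exports.

Local Open Scope classical_set_scope.
Local Open Scope ring_scope.

(** The flow of a vector field whose solutions do not cross is a homeomorphism
    from X to its image under the time-T map, and the image is open.  A component
    Phi_i is therefore an affine functional of the state, read in the coordinates
    given by the flow.  If the row A_i is nonzero, a linear change of coordinates
    turns this functional into the last coordinate, so every point of X is
    ordinary ([flow_functional_ordinary]).  If A_i = 0, then Phi_i is constant,
    and a constant function has no point with an index, because a quadratic form
    of full rank is not constant near 0 ([constant_no_index]).  Either way a
    topologically critical point contradicts the Morse property.

    The flow is only used backwards, near one trajectory h0: every terminal value
    y close to h0 T must be reached by a solution on the whole of [0, T], whose
    initial value depends continuously on y ([terminal_value_stability]).  This
    replaces invariance of domain; continuity of the inverse is then free by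
    compactness ([homeomorphism_onto_image_compact]).  As the vector field is
    merely continuous, stability comes from existence, compactness and uniqueness
    rather than from a Gronwall estimate.  The field is first truncated to a
    bounded, uniformly continuous one ([tame_truncation]).  If terminal values
    tending to h0 T had backward solutions leaving a tube around h0, a limit of
    these solutions would be a solution through h0 T, hence h0 itself
    ([solution_unique_in_tube]), although it differs from h0 at a limit of the
    escape times.

    Both this limit and the one in Peano's theorem are taken pointwise along an
    ultrafilter on the natural numbers.  No integral equation and no uniform
    convergence is needed, because approximate solutions are described by
    inequalities on increments with a modulus fixed in advance by the field
    ([approx_solution]); such inequalities pass to pointwise limits and still
    determine the derivative. *)

Set Implicit Arguments.
Unset Strict Implicit.

(** * Approximate solutions and the backward Euler scheme *)

Section peano.
Context {R : realType} {n : nat}.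
Implicit Types (T M e : R) (g : 'cV[R]_n -> R -> 'cV[R]_n) (mu : R -> R).

(** The modulus [mu] is part of the data because all approximate solutions have to
    share it.  The space increment is allowed to be [M * mu e] since that is how
    far an M-Lipschitz curve moves during a time [mu e]. *)
Definition tame_field T M mu g : Prop :=
  [/\ 0 < M,
      forall x t, 0 <= t <= T -> `|g x t| <= M &
      forall e, 0 < e -> 0 < mu e /\
        forall x x' t t', 0 <= t <= T -> 0 <= t' <= T ->
          `|t - t'| <= mu e -> `|x - x'| <= M * mu e ->
          `|g x t - g x' t'| <= e].

(** The error [e] is the mesh of a discretization; [e = 0] describes solutions
    whose difference quotients converge at the rate prescribed by [mu].  For each
    fixed [d], one half of [2 * d] pays for the variation of the slope along the
    curve, the other one for evaluating the field at a grid point.  Only times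
    [s <= t] are compared, the field being evaluated at the later one, from which
    a backward scheme starts. *)
Definition approx_solution T M mu g e (h : R -> 'cV[R]_n) : Prop :=
  forall s t, 0 <= s -> s <= t -> t <= T ->
    `|h s - h t| <= M * (t - s + e) /\
    forall d, 0 < d -> t - s + e < mu d ->
      `|h s - h t + (t - s) *: g (h t) t| <= 2 * d * (t - s) + (d + M) * e.

Fixpoint backward_euler T tau g (y : 'cV[R]_n) (k : nat) : 'cV[R]_n :=
  if k is k'.+1 then
    let v := backward_euler T tau g y k' in v - tau *: g v (T - k'%:R * tau)
  else y.

Lemma backward_euler_lipschitz T M mu g tau y a b :
  tame_field T M mu g -> 0 < tau -> (a <= b)%N -> b%:R * tau <= T ->
  `|backward_euler T tau g y b - backward_euler T tau g y a|
    <= M * ((b - a)%:R * tau).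
Proof.
move=> [/ltW M0 gM _] tau0; elim: b => [|b IH] ab bT.
  have -> : a = 0%N by lia.
  by rewrite subrr normr0 mul0r mulr0.
have [->|neq] := eqVneq a b.+1; first by rewrite subrr normr0 subnn mul0r mulr0.
have {}ab : (a <= b)%N by lia.
have bT' : b%:R * tau <= T.
  by apply: le_trans bT; rewrite ler_pM2r// ler_nat.
rewrite /= addrAC (le_trans (ler_normB _ _))//.
have := IH ab bT'; rewrite subSn//.
have : `|tau *: g (backward_euler T tau g y b) (T - b%:R * tau)| <= M * tau.
  rewrite normrZ gtr0_norm// mulrC ler_pM2r// gM//.
  by rewrite subr_ge0 bT' lerBlDr lerDl mulr_ge0// ltW.
rewrite -[in X in _ -> _ -> X]natr1; lra.
Qed.

(** As long as the scheme moves for a time less than [mu d], all the slopes that it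
    meets are [d]-close to the first one. *)
Lemma backward_euler_slope T M mu g tau y d a b :
  tame_field T M mu g -> 0 < tau -> 0 < d -> (a <= b)%N -> b%:R * tau <= T ->
  (b - a)%:R * tau <= mu d ->
  `|backward_euler T tau g y b - backward_euler T tau g y a
     + ((b - a)%:R * tau) *: g (backward_euler T tau g y a) (T - a%:R * tau)|
    <= d * ((b - a)%:R * tau).
Proof.
move=> tg tau0 d0; have [/ltW M0 gM /(_ _ d0)[mud gmu]] := tg.
elim: b => [|b IH] ab bT bamu.
  have -> : a = 0%N by lia.
  by rewrite subrr mul0r scale0r addr0 normr0 mulr0.
have [->|neq] := eqVneq a b.+1.
  by rewrite subrr subnn mul0r scale0r addr0 normr0 mulr0.
have {}ab : (a <= b)%N by lia.
have bT' : b%:R * tau <= T.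
  by apply: le_trans bT; rewrite ler_pM2r// ler_nat.
have amu : (b - a)%:R * tau <= mu d.
  by apply: le_trans bamu; rewrite ler_pM2r// ler_nat; lia.
have aT : a%:R * tau <= T.
  by apply: le_trans bT'; rewrite ler_pM2r// ler_nat.
rewrite /= subSn// -natr1.
set vb := backward_euler T tau g y b; set va := backward_euler T tau g y a.
have key : `|g va (T - a%:R * tau) - g vb (T - b%:R * tau)| <= d.
  apply: gmu.
  - by rewrite subr_ge0 aT lerBlDr lerDl mulr_ge0// ltW.
  - by rewrite subr_ge0 bT' lerBlDr lerDl mulr_ge0// ltW.
  - rewrite [X in `|X|](_ : _ = (b - a)%:R * tau) ?ger0_norm ?mulr_ge0 ?(ltW tau0)//.
    by rewrite natrB// mulrBl; ring.
  - rewrite distrC (le_trans (backward_euler_lipschitz _ tg _ _ _))//.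
    by rewrite ler_wpM2l.
rewrite [X in `|X|](_ : _ = (vb - va + ((b - a)%:R * tau) *: g va (T - a%:R * tau))
   + tau *: (g va (T - a%:R * tau) - g vb (T - b%:R * tau))); last first.
  by apply/matrixP => i j; rewrite !mxE; ring.
rewrite (le_trans (ler_normD _ _))//.
have := IH ab bT' amu; rewrite -/vb -/va.
have : `|tau *: (g va (T - a%:R * tau) - g vb (T - b%:R * tau))| <= d * tau.
  by rewrite normrZ gtr0_norm// mulrC ler_pM2r.
lra.
Qed.

(** The step function through the Euler points suffices, without linear
    interpolation: its jumps are of the size of the mesh, which [approx_solution]
    tolerates. *)
Lemma approx_solution_backward_euler T M mu g tau y :
  tame_field T M mu g -> 0 < tau ->
  approx_solution T M mu g tau
    (fun t => backward_euler T tau g y (Num.truncn ((T - t) / tau))).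
Proof.
move=> tg tau0 s t s0 st tT.
have [M0 gM gmu] := tg.
set a := Num.truncn ((T - t) / tau); set b := Num.truncn ((T - s) / tau).
have ab : (a <= b)%N.
  by apply: le_truncn; rewrite ler_pM2r ?invr_gt0//; lra.
have /andP[a1 a2] : a%:R * tau <= T - t < (a%:R + 1) * tau.
  rewrite -ler_pdivlMr// -ltr_pdivrMr// natr1; apply: truncn_itv.
  by rewrite divr_ge0 ?(ltW tau0)// subr_ge0.
have /andP[b1 b2] : b%:R * tau <= T - s < (b%:R + 1) * tau.
  rewrite -ler_pdivlMr// -ltr_pdivrMr// natr1; apply: truncn_itv.
  by rewrite divr_ge0 ?(ltW tau0)//; lra.
have abE : (b - a)%:R * tau = b%:R * tau - a%:R * tau by rewrite natrB// mulrBl.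
have bT : b%:R * tau <= T by lra.
have Lip := backward_euler_lipschitz y tg tau0 ab bT.
split=> [|d d0 dmu].
  by apply: le_trans Lip _; rewrite ler_wpM2l ?(ltW M0)// abE; lra.
have slope : (b - a)%:R * tau <= mu d by rewrite abE; lra.
have := backward_euler_slope y tg tau0 d0 ab bT slope.
set va := backward_euler T tau g y a; set vb := backward_euler T tau g y b.
set r := (b - a)%:R * tau => K1.
have [mud /(_ va va t (T - a%:R * tau))] := gmu d d0.
have tT' : 0 <= t <= T by lra.
have aT' : 0 <= T - a%:R * tau <= T.
  by apply/andP; split; [lra | rewrite lerBlDr lerDl mulr_ge0// ltW].
have tt' : `|t - (T - a%:R * tau)| <= mu d.
  by rewrite ler_norml; apply/andP; split; lra.
rewrite subrr normr0 (mulr_ge0 (ltW M0) (ltW mud)) => /(_ tT' aT' tt' isT) K2.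
have K3 := gM va _ aT'.
rewrite [X in `|X|](_ : _ = (vb - va + r *: g va (T - a%:R * tau))
   + (t - s - r) *: g va (T - a%:R * tau)
   + (t - s) *: (g va t - g va (T - a%:R * tau))); last first.
  by apply/matrixP => i j; rewrite !mxE; ring.
apply: (le_trans (ler_normD _ _)); apply: (le_trans (lerD (ler_normD _ _) (lexx _))).
have K4 : `|(t - s - r) *: g va (T - a%:R * tau)| <= tau * M.
  rewrite normrZ ler_pM// ler_norml; apply/andP; split; rewrite /r abE; lra.
have K5 : `|(t - s) *: (g va t - g va (T - a%:R * tau))| <= (t - s) * d.
  by rewrite normrZ ger0_norm ?subr_ge0// ler_wpM2l ?subr_ge0.
have K6 : d * r <= d * (t - s + tau) by rewrite ler_wpM2l ?(ltW d0)// /r abE; lra.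
lra.
Qed.

Lemma tame_field_cvg T M mu g (I : Type) (F : set_system I) {FF : Filter F}
    (x : I -> 'cV[R]_n) x0 t :
  tame_field T M mu g -> 0 <= t <= T -> x @ F --> x0 ->
  g (x i) t @[i --> F] --> g x0 t.
Proof.
move=> [M0 _ gmu] tT xx0; apply/cvgrPdist_le => e e0.
have [mue gmue] := gmu _ e0.
have /cvgrPdist_le/(_ _ (mulr_gt0 M0 mue)) := xx0.
apply: filterS => i xi; apply: gmue => //.
by rewrite subrr normr0 ltW.
Qed.

(** The defining inequalities are closed and involve two times at once, so that
    pointwise convergence is enough; the limit satisfies them with error 0. *)
Lemma approx_solution_lim T M mu g (F : set_system nat)
    {FF : ProperFilter F} (hs : nat -> R -> 'cV[R]_n) (es : nat -> R) h :
  tame_field T M mu g ->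
  (forall i, approx_solution T M mu g (es i) (hs i)) ->
  es @ F --> (0 : R) ->
  (forall t, 0 <= t <= T -> hs i t @[i --> F] --> h t) ->
  approx_solution T M mu g 0 h.
Proof.
move=> tg happ es0 hsh s t s0 st tT.
have hs_s : hs i s @[i --> F] --> h s by apply: hsh; lra.
have hs_t : hs i t @[i --> F] --> h t by apply: hsh; lra.
have gt_ : g (hs i t) t @[i --> F] --> g (h t) t.
  by apply: (tame_field_cvg tg) => //; lra.
split=> [|d d0 dmu].
  apply: (@ler_cvg_to nat F FF R (fun i => `|hs i s - hs i t|)
           (fun i => M * (t - s + es i))).
  - by apply: cvg_norm; exact: cvgB.
  - by apply: cvgMr; apply: cvgD => //; exact: cvg_cst.
  - by apply: nearW => i; have [] := happ i s t s0 st tT.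
apply: (@ler_cvg_to nat F FF R
  (fun i => `|hs i s - hs i t + (t - s) *: g (hs i t) t|)
  (fun i => 2 * d * (t - s) + (d + M) * es i)).
- by apply: cvg_norm; apply: cvgD; [exact: cvgB|exact: cvgZr].
- by apply: cvgD; [exact: cvg_cst|exact: cvgMr].
- have : \forall i \near F, es i < mu d - (t - s).
    by apply: (cvgr_lt _ es0); lra.
  apply: filterS => i ei; have [_ H] := happ i s t s0 st tT.
  by apply: H => //; lra.
Qed.

End peano.

(** * Compactness of bounded families of approximate solutions *)

Lemma ultra_fmap (I J : Type) (F : set_system I) (f : I -> J) :
  UltraFilter F -> UltraFilter (f @ F).
Proof.
move=> FU; have FF := @ultra_proper _ _ FU; split; first exact: fmap_proper_filter.
move=> G PG FG; apply/predeqP => A; split=> [GA|]; last exact: FG.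
have [//|FnA] := in_ultra_setVsetC (f @^-1` A) FU.
have /FG GnA : (f @ F) (~` A) by [].
by have [x []] := filter_ex (filterI GA GnA).
Qed.

(** Unfolds the filter in which [ode_solution] takes its difference quotients. *)
Lemma near_within_dnbhsP (R : realType) (A : set R) (t : R) (P : set R) :
  (\forall s \near within A t^', P s) <->
  exists2 d, 0 < d & forall s, A s -> s != t -> `|t - s| < d -> P s.
Proof.
split=> [/nbhs_ballP[d /= d0 H]|[d d0 H]].
  by exists d => // s As st ts; exact: H.
by apply/nbhs_ballP; exists d => //= s ts st As; exact: H.
Qed.

Section compactness.
Context {R : realType} {n : nat}.
Implicit Types (T M e : R) (g : 'cV[R]_n -> R -> 'cV[R]_n) (mu : R -> R).

Lemma norm_cV_leP (x : 'cV[R]_n) (B : R) :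
  0 <= B -> `|x| <= B <-> forall i, `|x i 0| <= B.
Proof.
move=> B0; rewrite {1}/Num.norm/= mx_normrE; split.
  by move=> /bigmax_leP[_ H] i; exact: (H (i, 0)).
by move=> H; apply/bigmax_leP; split=> // -[i j] _ /=; rewrite ord1.
Qed.

Lemma trmx_continuous m p : continuous (@trmx R m p).
Proof.
move=> A S /nbhs_ballP[e /= e0 AeS]; apply/nbhs_ballP; exists e => //= B [_ H].
by apply: AeS; split=> // i j; rewrite !mxE; exact: H.
Qed.

Lemma closed_norm_ball_compact (B : R) : compact [set x : 'cV[R]_n | `|x| <= B].
Proof.
have [B0|B0] := ltP B 0.
  rewrite (_ : mkset _ = set0); first exact: compact0.
  by rewrite -subset0 => x /= /le_lt_trans/(_ B0); rewrite normr_lt0.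
have K : compact [set v : 'rV[R]_n | forall i, v ord0 i \in `[- B, B]].
  by apply: (@rV_compact _ _ (fun=> `[- B, B]%classic)) => _; exact: segment_compact.
have := continuous_compact (continuous_subspaceT (@trmx_continuous _ _)) K.
congr compact; rewrite predeqE => x; split=> [[v Hv <-]|xB] /=.
  by apply/norm_cV_leP => // i; rewrite mxE ler_norml; exact: Hv.
exists x^T; last by rewrite trmxK.
by move=> i; rewrite mxE in_itv /= -ler_norml; move/norm_cV_leP : xB; exact.
Qed.

(** A substitute for the Arzela-Ascoli theorem: along an ultrafilter, bounded
    sequences in a finite-dimensional space converge at every time at once, without
    extracting subsequences. *)
Lemma approx_solution_compact T M mu g (F : set_system nat)
    (hs : nat -> R -> 'cV[R]_n) (es : nat -> R) (B : R) :
  UltraFilter F ->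
  tame_field T M mu g ->
  (forall k, approx_solution T M mu g (es k) (hs k)) ->
  es @ F --> (0 : R) ->
  (forall k t, 0 <= t <= T -> `|hs k t| <= B) ->
  exists2 h, approx_solution T M mu g 0 h &
    forall t, 0 <= t <= T -> hs k t @[k --> F] --> h t.
Proof.
move=> FU tg happ es0 hB; have FF := @ultra_proper _ _ FU.
have ex t : exists x : 'cV[R]_n, 0 <= t <= T -> hs k t @[k --> F] --> x.
  have [tT|] := boolP (0 <= t <= T); last by exists 0.
  have := @closed_norm_ball_compact B; rewrite compact_ultra.
  move=> /(_ _ (ultra_fmap (fun k => hs k t) FU))[].
    by apply: nearW => k; exact: hB.
  by move=> x [_ ?]; exists x.
have [h hP] := choice ex.
by exists h; [exact: (approx_solution_lim tg happ es0 hP)|exact: hP].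
Qed.

Lemma exists_free_ultrafilter :
  exists F : set_system nat, UltraFilter F /\ \oo `<=` F.
Proof. by have [F [FU sF]] := ultraFilterLemma eventually_filter; exists F. Qed.

(** Peano's theorem for a terminal value, as the limit of Euler schemes with mesh
    tending to 0. *)
Lemma peano_backward T M mu g y : 0 <= T -> tame_field T M mu g ->
  exists2 h, approx_solution T M mu g 0 h & h T = y.
Proof.
move=> T0 tg; have [M0 _ _] := tg.
have [F [FU sF]] := exists_free_ultrafilter; have FF := @ultra_proper _ _ FU.
pose es k : R := k.+1%:R^-1.
have es_gt0 k : 0 < es k by rewrite invr_gt0 ltr0n.
pose hs k t := backward_euler T (es k) g y (Num.truncn ((T - t) / es k)).
have hsT k : hs k T = y by rewrite /hs subrr mul0r truncn0.
have happ k : approx_solution T M mu g (es k) (hs k).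
  exact: approx_solution_backward_euler.
have es0 : es @ F --> (0 : R).
  by apply: cvg_trans (@cvg_harmonic R); exact: cvg_app.
have [k t /andP[t0 tT]|] := @approx_solution_compact T M mu g F hs es
  (`|y| + M * (T + 1)) FU tg happ es0.
  have [+ _] := happ k t T t0 tT (lexx _); rewrite hsT => H.
  have -> : hs k t = y + (hs k t - y) by rewrite addrC subrK.
  rewrite (le_trans (ler_normD _ _))// lerD2l (le_trans H)// ler_pM2l// lerD//.
    by lra.
  by rewrite invf_le1 ?ltr0n// ler1n.
move=> h happ0 hsh; exists h => //.
have TT : 0 <= T <= T by rewrite T0 lexx.
apply: (cvg_unique _ (hsh T TT)) => //; rewrite /=.
by under eq_fun do rewrite hsT; exact: cvg_cst.
Qed.

(** The definition compares increments with the slope at the later time only; the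
    other case costs one more [d], the variation of the slope between the times. *)
Lemma approx_solution0_diff T M mu g h d s t :
  tame_field T M mu g -> approx_solution T M mu g 0 h ->
  0 < d -> 0 <= s <= T -> 0 <= t <= T -> `|s - t| < mu d ->
  `|h s - h t - (s - t) *: g (h t) t| <= 3 * d * `|s - t|.
Proof.
move=> [M0 _ gmu] happ d0 sT tT st.
have [mud gmud] := gmu d d0.
have [le_st|lt_ts] := leP s t.
  have [|||_ /(_ d d0)] := happ s t; [lra..|].
  rewrite ler0_norm ?subr_le0// opprB in st *.
  rewrite mulr0 !addr0 => /(_ st).
  rewrite -[s - t]opprB scaleNr opprK => /le_trans; apply.
  by rewrite ler_wpM2r ?subr_ge0//; lra.
have [|||L /(_ d d0)] := happ t s; [lra..|].
rewrite gtr0_norm ?subr_gt0// in st *.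
rewrite mulr0 !addr0 in L * => /(_ st) K.
have K2 : `|g (h s) s - g (h t) t| <= d.
  apply: gmud => //; first by rewrite gtr0_norm ?subr_gt0// ltW.
  rewrite distrC (le_trans L)// ler_wpM2l ?(ltW M0)// ltW//.
rewrite [X in `|X|](_ : _ = - (h t - h s + (s - t) *: g (h s) s)
   + (s - t) *: (g (h s) s - g (h t) t)); last first.
  by apply/matrixP => i j; rewrite !mxE; ring.
rewrite (le_trans (ler_normD _ _))// normrN.
have : `|(s - t) *: (g (h s) s - g (h t) t)| <= (s - t) * d.
  by rewrite normrZ gtr0_norm ?subr_gt0// ler_wpM2l// subr_ge0 ltW.
lra.
Qed.

Lemma approx_solution0_ode T M mu g h :
  tame_field T M mu g -> approx_solution T M mu g 0 h ->
  ode_solution g `[0, T] h.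
Proof.
move=> tg happ t tT; rewrite in_itv/= in tT.
apply/cvgrPdist_le => e e0; apply/near_within_dnbhsP.
have d0 : 0 < e / 3 by rewrite divr_gt0.
have [_ _ /(_ _ d0)[mud _]] := tg.
exists (mu (e / 3)) => // s sT st; rewrite distrC => std.
rewrite /= in_itv/= in sT.
have := approx_solution0_diff tg happ d0 sT tT std.
have st0 : 0 < `|s - t| by rewrite normr_gt0 subr_eq0.
have -> : g (h t) t - (s - t)^-1 *: (h s - h t)
    = - ((s - t)^-1 *: (h s - h t - (s - t) *: g (h t) t)).
  by rewrite [in RHS]scalerBr [in RHS]scalerA mulVf ?subr_eq0// scale1r opprB.
rewrite normrN normrZ normfV ler_pdivrMl// => /le_trans; apply.
by rewrite le_eqVlt; apply/orP; left; apply/eqP; field.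
Qed.

End compactness.

(** * Truncation of a continuous vector field *)

(** The Heine-Cantor theorem for a function that is continuous on the compact set
    only, as vector fields are on a box times [0, T]. *)
Lemma compact_uniformly_continuous (R : realType) (U : pseudoMetricType R)
    (V : normedModType R) (K : set U) (F : U -> V) (e : R) :
  compact K -> {within K, continuous F} -> 0 < e ->
  exists2 d, 0 < d & forall p q, K p -> K q -> ball p d q -> `|F p - F q| <= e.
Proof.
move=> Kc Fc e0.
have /near_covering_withinP Kcov : near_covering K by apply/compact_near_coveringP.
have H : forall p, K p -> \forall p' \near p & d \near 0^'+, K p' ->
    forall q, K q -> ball p' d q -> `|F p' - F q| <= e.
  move=> p Kp.
  have /subspace_continuousP/(_ p Kp)/cvgrPdist_lt/(_ (e / 2)) := Fc.
  rewrite divr_gt0// => /(_ isT)/nbhs_ballP[r /= r0 Hr].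
  exists (ball p (r / 2), [set d | d < r / 2]); first split => /=.
  - by apply: nbhsx_ballx; rewrite divr_gt0.
  - by apply: nbhs_right_lt; rewrite divr_gt0.
  move=> [p' d]/= [pp' dr] Kp' q Kq p'q.
  have h1 : `|F p - F p'| < e / 2.
    by apply: Hr => //; apply: le_ball pp'; lra.
  have h2 : `|F p - F q| < e / 2.
    apply: Hr => //; rewrite (splitr r); apply: ball_triangle pp' _.
    by apply: le_ball p'q; exact: ltW.
  rewrite (le_trans (ler_distD (F p) _ _))// (distrC (F p')); lra.
have {}H := Kcov _ _ _ (at_right_proper_filter 0) H.
have [d [d0 Hd]] := filter_ex (filterI (nbhs_right_gt 0) H).
by exists d => // p q Kp Kq; exact: Hd.
Qed.

Section truncation.
Context {R : realType} {n : nat}.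
Implicit Types (T M e : R) (f g : 'cV[R]_n -> R -> 'cV[R]_n).

Definition clamp (B : R) (x : 'cV[R]_n) : 'cV[R]_n :=
  \col_i Num.max (- B) (Num.min B (x i 0)).

Lemma clamp_id B x : `|x| <= B -> clamp B x = x.
Proof.
move=> xB; have B0 : 0 <= B by apply: le_trans xB.
apply/matrixP => i j; rewrite mxE ord1.
have := (norm_cV_leP x B0).1 xB i; rewrite ler_norml => /andP[a b].
by rewrite min_r// max_r.
Qed.

Lemma norm_clamp B x : 0 <= B -> `|clamp B x| <= B.
Proof.
move=> B0; apply/norm_cV_leP => // i; rewrite mxE ler_norml.
by rewrite le_max lexx/= ge_max ge_min lexx/= andbT; lra.
Qed.

Lemma clamp_contract B x y : `|clamp B x - clamp B y| <= `|x - y|.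
Proof.
apply/norm_cV_leP => // i; rewrite !mxE.
have := (norm_cV_leP (x - y) (normr_ge0 _)).1 (lexx _) i; rewrite !mxE.
apply: le_trans; rewrite !maxEle !minEle.
by case: ifPn; case: ifPn; case: ifPn; case: ifPn;
  rewrite -?ltNge => *; rewrite ler_norml; case: (ler0P (x i 0 - y i 0)) => *;
  apply/andP; split; lra.
Qed.

(** The coordinatewise clamp is 1-Lipschitz for the sup norm and has values in a
    compact box, so that composing with it makes the field bounded and uniformly
    continuous while preserving the solutions that stay in the box. *)
Lemma tame_truncation T f B :
  0 <= B -> vector_field_continuous T f ->
  exists M mu, tame_field T M mu (fun x t => f (clamp B x) t).
Proof.
move=> B0 fc.
pose K : set ('cV[R]_n * R) := [set x | `|x| <= B] `*` `[0, T]%classic.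
have Kc : compact K.
  by apply: compact_setX; [exact: closed_norm_ball_compact|exact: segment_compact].
have Fc : {within K, continuous (fun p : 'cV[R]_n * R => f p.1 p.2)}.
  by apply: continuous_subspaceW fc => -[x t] [_ ?].
have KP x t : 0 <= t <= T -> K (clamp B x, t).
  by move=> tT; split; [exact: norm_clamp|rewrite /= in_itv].
have [M0 [_ HM]] := compact_bounded (continuous_compact Fc Kc).
pose M := `|M0| + 1.
have M1 : 1 <= M by rewrite lerDr.
have ex e : exists d, 0 < e -> 0 < d /\ forall p q, K p -> K q -> ball p d q ->
    `|f p.1 p.2 - f q.1 q.2| <= e.
  have [e0|e0] := ltP 0 e; last by exists 0.
  have [d d0 H] := compact_uniformly_continuous Kc Fc e0.
  by exists d.
have [mu muP] := choice ex.
(* balls are open, whence the factor 2 *)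
exists M, (fun e => mu e / (2 * M)); split; first lra.
  move=> x t tT; apply: (HM M).
    by rewrite (le_lt_trans (ler_norm M0))// ltrDl.
  by exists (clamp B x, t) => //; exact: KP.
move=> e /muP[mue gmu]; split; first by rewrite divr_gt0//; lra.
have l1 : mu e / (2 * M) < mu e.
  by rewrite ltr_pdivrMr ?ltr_pMr //; lra.
have l2 : M * (mu e / (2 * M)) < mu e.
  have -> : M * (mu e / (2 * M)) = mu e / 2 by field; apply/eqP; lra.
  by lra.
move=> x x' t t' tT tT' tt' xx'.
apply: (gmu (clamp B x, t) (clamp B x', t')); [exact: KP|exact: KP|].
split; rewrite /= -ball_normE /ball_/=.
  by rewrite (le_lt_trans (clamp_contract _ _ _))// (le_lt_trans xx').
exact: le_lt_trans tt' l1.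
Qed.

End truncation.

(** * Solutions near a given trajectory *)

Section perturbation.
Context {R : realType} {n : nat}.
Implicit Types (T M e : R) (f g : 'cV[R]_n -> R -> 'cV[R]_n).

Lemma ode_solution_sub f g (J J' : interval R) h :
  ode_solution g J h -> [set` J'] `<=` [set` J] ->
  (forall t, t \in J' -> g (h t) t = f (h t) t) -> ode_solution f J' h.
Proof.
move=> hg sJ gf t tJ'; rewrite -gf//.
apply: cvg_trans (hg t (sJ t tJ')).
by apply: cvg_app; exact: within_subset.
Qed.

Lemma ode_solution_continuous f (J : interval R) h :
  ode_solution f J h -> {within [set` J], continuous h}.
Proof.
move=> hf; apply/subspace_continuousP => t tJ.
have /cvgrPdist_le/(_ 1 ltr01)/near_within_dnbhsP[d d0 H] := hf t tJ.
apply/cvgrPdist_le => e e0.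
pose c := `|f (h t) t| + 1; have c0 : 0 < c by rewrite ltr_wpDl.
apply/nbhs_ballP; exists (Num.min d (e / c)); first by rewrite /= lt_min d0 divr_gt0.
move=> s /=; rewrite /ball/= lt_min => /andP[ts tse] sJ.
have [->|st] := eqVneq s t; first by rewrite subrr normr0 ltW.
have {H} := H s sJ st ts; rewrite distrC => H.
have st0 : s - t != 0 by rewrite subr_eq0.
have L : `|(s - t)^-1 *: (h s - h t)| <= c.
  rewrite -(subrK (f (h t) t) (_ *: _)) (le_trans (ler_normD _ _))//.
  by rewrite addrC lerD2l.
rewrite distrC -[h s - h t](scalerKV st0) normrZ.
rewrite (le_trans (ler_wpM2l _ L))// -ler_pdivlMr// distrC; exact: ltW.
Qed.

(** The solution [h] of the modified field is compared with [h0] on an interval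
    open on the left: if [t1] is the last time at which they are at distance at
    least 1, then [h] solves the original equation on ]t1, T], hence equals [h0]
    there, and by continuity at [t1] too. *)
Lemma solution_unique_in_tube T f g h0 h :
  0 <= T -> solutions_do_not_cross T f ->
  ode_solution f `[0, T] h0 -> ode_solution g `[0, T] h ->
  (forall t, 0 <= t <= T -> `|h t - h0 t| < 1 -> g (h t) t = f (h t) t) ->
  h T = h0 T -> forall t, 0 <= t <= T -> h t = h0 t.
Proof.
move=> T0 nocross h0f hg gf hT.
have TT : T \in `[0, T] by rewrite in_itv/= T0 lexx.
pose d t := `|h t - h0 t|.
have dc : {within `[0, T], continuous d}.
  have /subspace_continuousP c1 := ode_solution_continuous hg.
  have /subspace_continuousP c2 := ode_solution_continuous h0f.
  apply/subspace_continuousP => t tT; apply: cvg_norm.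
  by apply: cvgB; [exact: c1|exact: c2].
have agree (J : interval R) : [set` J] `<=` `[0, T] -> T \in J ->
    (forall t, t \in J -> d t < 1) -> forall t, t \in J -> h t = h0 t.
  move=> sJ TJ dJ t tJ.
  apply: (nocross J `[0, T] h h0) => //; last exact: sJ.
    apply: (ode_solution_sub hg sJ) => s sJ'; apply: gf; last exact: dJ.
    by have := sJ s sJ'; rewrite /= in_itv.
  by exists T.
suff small : forall t, t \in `[0, T] -> d t < 1.
  by move=> t tT; apply: (agree `[0, T]) => //; rewrite in_itv.
apply: contrapT => /existsNP[t0 /not_implyP[t0T /negP]].
rewrite -leNgt => dt0.
pose C := [set t | t \in `[0, T] /\ 1 <= d t].
have C0 : C !=set0 by exists t0.
have CT : ubound C T by move=> t [+ _]; rewrite in_itv/= => /andP[].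
have supC : has_sup C by split => //; exists T.
pose t1 := sup C.
have t0t1 : t0 <= t1 by apply: ub_le_sup; [case: supC|split].
have t1T : t1 <= T by apply: ge_sup.
have t1in : t1 \in `[0, T].
  by move: t0T; rewrite !in_itv/= => /andP[a _]; rewrite t1T andbT (le_trans a).
have /subspace_continuousP/(_ t1 t1in)/cvgrPdist_lt dt1 := dc.
have near_t1 e : 0 < e -> exists2 r, 0 < r &
    forall s, s \in `[0, T] -> `|t1 - s| < r -> `|d t1 - d s| < e.
  by move=> /dt1/nbhs_ballP[r /= r0 H]; exists r => // s sT st; exact: H.
have d1 : 1 <= d t1.
  rewrite leNgt; apply/negP => lt1.
  have [|r r0 Hr] := near_t1 (1 - d t1); first by rewrite subr_gt0.
  have [t [tT dt] tr] := sup_adherent r0 supC.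
  have tt1 : t <= t1 by apply: ub_le_sup => //; case: supC.
  rewrite -/t1 in tr.
  have := Hr t tT; rewrite ger0_norm ?subr_ge0// ltrBlDl -ltrBlDr => /(_ tr).
  by rewrite ltr_norml => /andP[]; lra.
have t1ltT : t1 < T.
  rewrite lt_neqAle t1T andbT; apply/eqP => t1E.
  by move: d1; rewrite t1E /d hT subrr normr0 ler10.
have after t : t \in `]t1, T] -> h t = h0 t.
  apply: agree.
  - move=> s /=; rewrite !in_itv/= => /andP[s1 ->]; rewrite andbT.
    by move: t1in; rewrite in_itv/= => /andP[a _]; rewrite (le_trans a)// ltW.
  - by rewrite in_itv/= t1ltT lexx.
  - move=> s; rewrite in_itv/= => /andP[s1 sT]; rewrite ltNge; apply/negP => ds.
    have s0 : s \in `[0, T].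
      move: t1in; rewrite !in_itv/= => /andP[a _].
      by rewrite sT andbT (le_trans a)// ltW.
    move: s1; rewrite ltNge => /negP; apply.
    by apply: ub_le_sup; [case: supC|split].
have [r r0 Hr] := near_t1 1 ltr01.
pose s := Num.min T (t1 + r / 2).
have t1s : t1 < s by rewrite lt_min t1ltT ltrDl divr_gt0.
have sT : s <= T by rewrite ge_min lexx.
have sr : s <= t1 + r / 2 by rewrite ge_min lexx orbT.
have sT' : s \in `[0, T].
  move: t1in; rewrite !in_itv/= => /andP[a _].
  by rewrite sT andbT (le_trans a)// ltW.
have t1sr : `|t1 - s| < r by rewrite ltr_norml; apply/andP; split; lra.
have ds : d s = 0 by rewrite /d after ?subrr ?normr0// in_itv/= t1s.
by have := Hr s sT' t1sr; rewrite ds subr0 ltr_norml => /andP[]; lra.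
Qed.

End perturbation.

Section stability.
Context {R : realType} {n : nat}.
Implicit Types (T M e : R) (f g : 'cV[R]_n -> R -> 'cV[R]_n).

Lemma approx_solution0_lipschitz T M mu g h s t :
  approx_solution T M mu g 0 h -> 0 <= s <= T -> 0 <= t <= T ->
  `|h s - h t| <= M * `|s - t|.
Proof.
move=> hg /andP[s0 sT] /andP[t0 tT].
wlog st : s t s0 sT t0 tT / s <= t.
  move=> H; have [|/ltW] := leP s t; first exact: H.
  by move=> ts; rewrite distrC [in leRHS]distrC; exact: H.
have [+ _] := hg s t s0 st tT; rewrite addr0 => /le_trans; apply.
by rewrite distrC ger0_norm ?subr_ge0.
Qed.

(** Existence and closeness are proved together: the backward solutions of the
    truncated field that end near [h0 T] cannot leave the tube around [h0], and
    inside the tube they solve the original equation. *)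
Lemma terminal_value_stability T f h0 e :
  0 <= T -> vector_field_continuous T f -> solutions_do_not_cross T f ->
  ode_solution f `[0, T] h0 -> 0 < e ->
  exists2 d, 0 < d & forall y, `|y - h0 T| < d ->
    exists h, [/\ ode_solution f `[0, T] h, h T = y & `|h 0 - h0 0| < e].
Proof.
move=> T0 fc nocross h0f e_gt0.
have h0c := ode_solution_continuous h0f.
have [B0 [_ HB]] := compact_bounded (continuous_compact h0c (@segment_compact R 0 T)).
have h0B t : 0 <= t <= T -> `|h0 t| <= `|B0| + 1.
  move=> tT; apply: (HB (`|B0| + 1)).
    by rewrite (le_lt_trans (ler_norm B0))// ltrDl.
  by exists t => //=; rewrite in_itv.
(* the tube of radius 1 around h0 lies where the truncation has no effect *)
pose B := `|B0| + 1 + 1.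
have B_ge0 : 0 <= B by rewrite /B; have := normr_ge0 B0; lra.
have [M [mu tg]] := tame_truncation B_ge0 fc.
set g := (fun x t => f (clamp B x) t) in tg.
have gf (h : R -> 'cV[R]_n) t : 0 <= t <= T -> `|h t - h0 t| < 1 ->
    g (h t) t = f (h t) t.
  move=> tT hh0; rewrite /g clamp_id//.
  rewrite -(subrK (h0 t) (h t)) (le_trans (ler_normD _ _))//.
  by have := h0B t tT; rewrite /B; lra.
pose e1 := Num.min e 1.
have e1_gt0 : 0 < e1 by rewrite lt_min e_gt0 ltr01.
apply: contrapT => nd.
(* the pairs consist of a backward solution and a time at which it is outside the
   tube *)
have esc k : exists ht : (R -> 'cV[R]_n) * R,
    [/\ approx_solution T M mu g 0 ht.1, `|ht.1 T - h0 T| < k.+1%:R^-1,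
        0 <= ht.2 <= T & e1 <= `|ht.1 ht.2 - h0 ht.2|].
  apply: contrapT => nesc; apply: nd; exists k.+1%:R^-1.
    by rewrite invr_gt0 ltr0n.
  move=> y yT; have [h hg hT] := peano_backward y T0 tg.
  have tube t : 0 <= t <= T -> `|h t - h0 t| < e1.
    move=> tT; rewrite ltNge; apply/negP => th; apply: nesc.
    by exists (h, t); split => //=; rewrite hT.
  exists h; split => //.
    apply: (ode_solution_sub (approx_solution0_ode tg hg)) => // t.
    rewrite in_itv/= => tT; apply: gf => //.
    by rewrite (lt_le_trans (tube t tT))// ge_min lexx orbT.
  rewrite (lt_le_trans (tube 0 _))//; first by rewrite lexx.
  by rewrite ge_min lexx.
have [ht htP] := choice esc.
pose hs k := (ht k).1; pose ts k := (ht k).2.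
have [F [FU sF]] := exists_free_ultrafilter; have FF := @ultra_proper _ _ FU.
have harm : (k.+1%:R^-1 : R) @[k --> F] --> (0 : R).
  by apply: cvg_trans (@cvg_harmonic R); exact: cvg_app.
have TT : 0 <= T <= T by rewrite T0 lexx.
have hsg k : approx_solution T M mu g 0 (hs k) by have [] := htP k.
have hsB k t : 0 <= t <= T -> `|hs k t| <= `|h0 T| + 1 + M * T.
  move=> tT; have [_ hkT _ _] := htP k; have [M0 _ _] := tg.
  have : `|hs k t - hs k T| <= M * T.
    rewrite (le_trans (approx_solution0_lipschitz (hsg k) tT TT))//.
    by rewrite ler_pM2l// distrC ger0_norm; lra.
  have : `|hs k T - h0 T| <= 1.
    by rewrite (le_trans (ltW hkT))// invf_le1 ?ltr0n// ler1n.
  have := ler_normD (hs k t - hs k T + (hs k T - h0 T)) (h0 T).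
  have := ler_normD (hs k t - hs k T) (hs k T - h0 T).
  rewrite (_ : hs k t - hs k T + (hs k T - h0 T) + h0 T = hs k t); first lra.
  by rewrite addrA subrK subrK.
have [h hg hsh] := approx_solution_compact FU tg hsg (cvg_cst (0 : R)) hsB.
have hT : h T = h0 T.
  suff hsT : hs k T @[k --> F] --> h0 T by apply: cvg_unique (hsh T TT) hsT.
  apply/cvgrPdist_lt => x x0.
  have small : F [set k | k.+1%:R^-1 < x] by exact: (cvgr_lt _ harm _ x0).
  apply: filterS small => k kx; have [_ + _ _] := htP k.
  by rewrite distrC => /lt_trans; apply.
have hh0 := solution_unique_in_tube T0 nocross h0f
  (approx_solution0_ode tg hg) (gf h) hT.
have := @segment_compact R 0 T; rewrite compact_ultra => /(_ _ (ultra_fmap ts FU))[].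
  by apply: nearW => k /=; rewrite in_itv; have [] := htP k.
move=> t [tT /= tst]; have tT' := tT; rewrite /= in_itv/= in tT.
have [M0 _ _] := tg.
have e4 : 0 < e1 / 4 by rewrite divr_gt0.
have e4M : 0 < e1 / 4 / M by rewrite divr_gt0.
have /subspace_continuousP/(_ t tT')/cvgrPdist_lt/(_ _ e4) := h0c.
move=> /nbhs_ballP[r /= r0 Hr].
have /cvgrPdist_lt tsd := tst.
have /cvgrPdist_lt/(_ _ e4) hst := hsh t tT; rewrite hh0// in hst.
(* three errors below e1 / 4 each: the motion of h_k from the escape time to its
   limit t, the distance at t, and the motion of h0 back to the escape time *)
have [k [[k1 k2] k3]] := filter_ex (filterI (filterI (tsd _ r0) (tsd _ e4M)) hst).
have [_ _ tsT esck] := htP k; rewrite -/(ts k) -/(hs k) in tsT esck.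
have a1 : `|h0 t - h0 (ts k)| < e1 / 4 by apply: Hr => //=; rewrite in_itv.
have a2 : `|hs k (ts k) - hs k t| <= e1 / 4.
  rewrite (le_trans (approx_solution0_lipschitz (hsg k) tsT tT))//.
  by rewrite -ler_pdivlMl// mulrC distrC ltW.
have := ler_normD (hs k (ts k) - hs k t + (hs k t - h0 t)) (h0 t - h0 (ts k)).
have := ler_normD (hs k (ts k) - hs k t) (hs k t - h0 t).
rewrite !addrA !subrK (distrC (hs k t)); lra.
Qed.

End stability.

(** A continuous injection on a compact set with values in a Hausdorff space
    maps closed subsets to compact, hence closed, sets. *)
Lemma homeomorphism_onto_image_compact (U V : topologicalType) (K : set U)
    (e : U -> V) (g : V -> U) :
  hausdorff_space V -> compact K -> {within K, continuous e} ->
  (forall u, K u -> g (e u) = u) -> homeomorphism_onto_image K e.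
Proof.
move=> hV Kc ec ge; split => //; exists g; split => //.
apply/subspace_continuousP => _ [u Ku <-]; rewrite /from_subspace ge// => N uN.
have cl : closed (e @` (K `&` ~` N^°)).
  apply: compact_closed => //; apply: continuous_compact.
    by apply: continuous_subspaceW ec => ? [].
  by apply: compact_closedI => //; apply: open_closedC; exact: open_interior.
have : nbhs (e u) (~` (e @` (K `&` ~` N^°))).
  apply: open_nbhs_nbhs; split; first exact: closed_openC.
  move=> [u' [Ku' nu'] euu']; apply: nu'.
  by rewrite -(ge _ Ku') euu' ge.
apply: filterS => y ny [u' Ku' u'y]; rewrite /= -u'y ge//.
apply: interior_subset; apply: contrapT => nu'; apply: ny.
by exists u'.
Qed.

(** A nonzero linear form can be completed to a system of coordinates, placed at
    any chosen index [j]. *)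
Lemma exists_unitmx_delta (F : fieldType) (n : nat) (r : 'rV[F]_n.+1) (j : 'I_n.+1) :
  r != 0 -> exists2 L, L \in unitmx & r *m L = delta_mx 0 j.
Proof.
move=> r0; pose B := row_ebase r; pose c := col_ebase r 0 0.
have c0 : c != 0.
  have := col_ebase_unit r; rewrite [col_ebase r]mx11_scalar -/c unitmxE det_scalar1.
  by rewrite unitfE.
have rE : r = c *: (delta_mx 0 0 *m B).
  rewrite -{1}(mulmx_ebase r) rank_rV r0 [col_ebase r]mx11_scalar -/c -/B.
  rewrite mul_scalar_mx -scalemxAl; congr (_ *: (_ *m _)).
  by apply/rowP => k; rewrite !mxE eqxx/= andbT eq_sym.
exists (c^-1 *: (invmx B *m tperm_mx 0 j)).
  rewrite unitmxZ ?unitfE ?invr_eq0// unitmx_mul unitmx_inv.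
  by rewrite row_ebase_unit unitmx_perm.
rewrite -scalemxAr {1}rE -scalemxAl scalerA mulVf// scale1r.
rewrite mulmxA mulmxK ?row_ebase_unit// -rowE.
by apply/rowP => k; rewrite !mxE tpermL eqxx eq_sym.
Qed.

(** * Points of X are ordinary for a nonconstant functional of the flow *)

Lemma mulmx_cV_bounded (R : realType) (m n : nat) (L : 'M[R]_(m, n)) :
  exists2 C, 0 < C & forall v : 'cV[R]_n, `|L *m v| <= C * `|v|.
Proof.
pose S i := \sum_j `|L i j|.
have S0 i : 0 <= S i by apply: sumr_ge0.
have Csum : 0 <= \sum_i S i by apply: sumr_ge0.
exists (\sum_i S i + 1); first by rewrite ltr_wpDl.
move=> v; apply/norm_cV_leP => [|i]; first by rewrite mulr_ge0// addr_ge0.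
have SC : S i <= \sum_i S i + 1.
  by rewrite (bigD1 i)//= -addrA lerDl addr_ge0// sumr_ge0.
rewrite mxE (le_trans (ler_norm_sum _ _ _))//.
apply: le_trans (ler_wpM2r (normr_ge0 v) SC).
rewrite mulr_suml; apply: ler_sum => j _; rewrite normrM ler_wpM2l//.
by have := (norm_cV_leP v (normr_ge0 v)).1 (lexx _) j.
Qed.

Section flow.
Context {R : realType} {n : nat}.
Implicit Types (T : R) (f : 'cV[R]_n.+1 -> R -> 'cV[R]_n.+1).

Lemma ivp_solP T f (X : set 'cV[R]_n.+1) x :
  ivp_exists T f X -> X x -> ivp_solution T f x (ivp_sol T f x).
Proof.
move=> ex /ex [h hx].
exact: (xgetPex (fun=> 0) (ex_intro _ h hx)).
Qed.

Lemma solutions_agree T f h1 h2 s t :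
  solutions_do_not_cross T f ->
  ode_solution f `[0, T] h1 -> ode_solution f `[0, T] h2 ->
  0 <= s <= T -> 0 <= t <= T -> h1 s = h2 s -> h1 t = h2 t.
Proof.
move=> nocross h1f h2f sT tT h12.
by apply: (nocross _ _ _ _ _ _ h1f h2f) => //; exists s.
Qed.

(** The chart sends [v] to the initial value of the solution that ends at
    [hp T + L *m v], where [hp] is the solution starting at [p] and [L] turns the
    functional [r] into the last coordinate.  Non-crossing makes the time-T map the
    inverse of the backward flow. *)
Lemma flow_functional_ordinary T f (X : set 'cV[R]_n.+1)
    (Psi : 'cV[R]_n.+1 -> R) (r : 'rV[R]_n.+1) (c : R) p :
  0 < T -> open X -> assumption1 T f X -> assumption2 T f ->
  (forall x, X x -> Psi x = (r *m ivp_sol T f x T) 0 0 + c) ->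
  r != 0 -> X p -> topologically_ordinary X Psi p.
Proof.
move=> T_gt0 oX [fc ex] [_ nocross] PsiE r0 Xp.
have T0 := ltW T_gt0.
have I0 : 0 <= (0 : R) <= T by rewrite lexx.
have IT : 0 <= T <= T by rewrite lexx andbT.
have [L Lu rL] := exists_unitmx_delta ord_max r0.
have [C C0 LC] := mulmx_cV_bounded L.
have [hpf hp0] := ivp_solP ex Xp.
set hp := ivp_sol T f p in hpf hp0.
have /nbhs_ballP[e /= e0 eX] : nbhs p X by apply: open_nbhs_nbhs.
have [d d0 Hd] := terminal_value_stability T0 fc nocross hpf e0.
have ex_back y : exists h, `|y - hp T| < d ->
    [/\ ode_solution f `[0, T] h, h T = y & `|h 0 - p| < e].
  have [yd|] := boolP (`|y - hp T| < d); last by exists (fun=> 0).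
  by have [h] := Hd y yd; rewrite hp0 => hP; exists h.
have [H HP] := choice ex_back.
pose rho := d / (2 * C).
have rho0 : 0 < rho by rewrite divr_gt0// mulr_gt0.
pose V := [set v : 'cV[R]_n.+1 | `|v| <= rho].
pose y v := hp T + L *m v.
pose eta v := H (y v) 0.
have yV v : V v -> `|y v - hp T| < d.
  move=> vV; rewrite /y addrC addKr (le_lt_trans (LC v))//.
  rewrite (@le_lt_trans _ _ (C * rho)) ?ler_pM2l//.
  have -> : C * rho = d / 2 by rewrite /rho; field; rewrite gt_eqF.
  lra.
have etaX v : V v -> X (eta v).
  move=> vV; have [_ _ ee] := HP _ (yV v vV).
  by apply: eX; rewrite -ball_normE /= distrC.
have flow_eta v : V v -> ivp_sol T f (eta v) T = y v.
  move=> vV; have [Hf HT _] := HP _ (yV v vV).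
  have [sf s0] := ivp_solP ex (etaX v vV).
  by rewrite (solutions_agree nocross sf Hf I0 IT s0).
have eta0 : eta 0 = p.
  have V0 : V 0 by rewrite /V/= normr0 ltW.
  have [Hf HT _] := HP _ (yV 0 V0).
  rewrite -hp0; apply: (solutions_agree nocross Hf hpf IT I0).
  by rewrite HT /y mulmx0 addr0.
exists V, eta; split => //.
- apply/nbhs_ballP; exists rho => //= v.
  by rewrite -ball_normE /= sub0r normrN => /ltW.
- pose g x := invmx L *m (ivp_sol T f x T - hp T).
  apply: (homeomorphism_onto_image_compact (g := g)).
  + exact: norm_hausdorff.
  + exact: closed_norm_ball_compact.
  + apply/subspace_continuousP => v vV; apply/cvgrPdist_lt => b b0.
    have [Hf HT _] := HP _ (yV v vV).
    have [q q0 Hq] := terminal_value_stability T0 fc nocross Hf b0.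
    apply/nbhs_ballP; exists (q / C) => /=; first by rewrite divr_gt0.
    move=> w; rewrite -ball_normE /= => vw wV.
    have [h [hf hT hb]] : exists h,
        [/\ ode_solution f `[0, T] h, h T = y w & `|h 0 - H (y v) 0| < b].
      apply: Hq; rewrite HT /y opprD addrACA subrr add0r -mulmxBr.
      rewrite (le_lt_trans (LC _))// mulrC -ltr_pdivlMr// distrC.
      exact: vw.
    have [Hwf HwT _] := HP _ (yV w wV).
    have Hwh : H (y w) 0 = h 0.
      by apply: (solutions_agree nocross Hwf hf IT I0); rewrite HwT hT.
    by rewrite distrC /from_subspace /eta Hwh.
  + by move=> v vV; rewrite /g flow_eta// /y addrC addKr mulKmx.
- by move=> _ [v vV <-]; exact: etaX.
- move=> v vV; rewrite (PsiE _ (etaX v vV)) flow_eta// (PsiE p Xp) -/hp.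
  rewrite /y mulmxDr mulmxA rL -rowE mxE !mxE addrAC.
  by [].
Qed.

(** On a coordinate axis the quadratic form of any index is plus or minus a
    square. *)
Lemma constant_no_index (X : set 'cV[R]_n.+1) (Psi : 'cV[R]_n.+1 -> R) c p k :
  (forall x, X x -> Psi x = c) -> X p -> ~ has_index X Psi p k.
Proof.
move=> PsiE Xp [U [mu [/nbhs_ballP[e /= e0 eU] _ muX _ muE]]].
pose u : 'cV[R]_n.+1 := (e / 2) *: delta_mx 0 0.
have uE j : u j 0 = (e / 2) *+ (j == 0).
  by rewrite !mxE eqxx andbT mulr_natr.
have Uu : U u.
  apply: eU; rewrite -ball_normE /= sub0r normrN.
  apply: (@le_lt_trans _ _ (e / 2)); last lra.
  apply/norm_cV_leP => [|j]; first by rewrite divr_ge0// ltW.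
  rewrite uE; case: (j == 0); rewrite ?mulr0n ?normr0 ?mulr1n ?ger0_norm//; lra.
have := muE u Uu; rewrite !PsiE//; last by apply: muX; exists u.
have u2 : 0 < (e / 2) ^+ 2 by rewrite exprn_gt0// divr_gt0.
have S (P : pred 'I_n.+1) :
    \sum_(j < n.+1 | P j) u j 0 ^+ 2 = (e / 2) ^+ 2 *+ P 0.
  case P0 : (P 0).
    rewrite (bigD1 0)//= uE eqxx big1 ?addr0// => j /andP[_ /negPf j0].
    by rewrite uE j0 expr0n.
  rewrite big1// => j Pj; rewrite uE; case: eqVneq => [j0|_]; last by rewrite expr0n.
  by rewrite -j0 Pj in P0.
rewrite !S; case: ltnP => k0; rewrite /= ?mulr0n ?mulr1n; lra.
Qed.

End flow.

Unset Implicit Arguments.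
Set Strict Implicit.

Theorem theorem2p9 (R : realType) (T : R) (hT : 0 < T) (n m : nat)
    (X : set 'cV[R]_n.+1) (hX : open X)
    (Phi : 'cV[R]_n.+1 -> 'cV[R]_m) (hPhi : {within X, continuous Phi})
    (hmorse : exists i : 'I_m,
       topological_morse X (fun x => Phi x i 0) /\
       exists p, topologically_critical X (fun x => Phi x i 0) p) :
  ~ exists (f : 'cV[R]_n.+1 -> R -> 'cV[R]_n.+1)
           (A : 'M[R]_(m, n.+1)) (a : 'cV[R]_m),
      [/\ assumption1 T f X, assumption2 T f &
        forall x, X x -> Phi x = NODE2 T f A a x].
Proof.
have [i [[_ morse] [p crit]]] := hmorse.
move=> [f [A [a [asm1 asm2 PhiE]]]].
have [Xp nord] := crit.
have PsiE x : X x -> Phi x i 0 = (row i A *m ivp_sol T f x T) 0 0 + a i 0.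
  by move=> Xx; rewrite PhiE// /NODE2 -row_mul !mxE.
have [A0|A0] := eqVneq (row i A) 0.
  have [k [_ idx]] := morse p crit.
  apply: constant_no_index idx => [x Xx|//].
  by rewrite PsiE// A0 mul0mx mxE add0r.
by apply: nord; exact: (flow_functional_ordinary hT hX asm1 asm2 PsiE A0 Xp).
Qed.
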